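(* Let $\omega,k\in\mathbb{R}$ with $k\neq 0$, $\omega+k\bar v\neq 0$ and $(\omega+k\bar v)^2\neq k^2(\bar c^2-\bar u^2)$, and let the damping parameter $\sigma=\sigma(\omega,k)\ge 0$ be independent of $x$. Consider the coupled problem in which the Fourier-transformed linearized Euler system $\hat A W_l=0$ is posed in the half-line $x<0$ and the first PML model $\hat A^{pml1}W_r=0$ is posed in the half-line $x>0$. The Euler solution is the general one, $$W_l(x)=\sum_{i=1}^{3}\alpha_i W_i e^{\lambda_i x},\qquad \alpha_1,\alpha_2,\alpha_3\in\mathbb{C},$$ and the PML solution is the general one without the mode that grows as $x\to+\infty$, $$W_r(x)=\sum_{i=1}^{2}\beta_i W_i^{pml1}e^{\lambda_i^{pml}x},\qquad \beta_1,\beta_2\in\mathbb{C}.$$ Suppose that at $x=0$ the following interface conditions hold: $$\hat{\mathcal L}\big((F W_l)_3\big)=\hat{\mathcal L}^{pml}\big((F W_r)_3\big),\qquad \hat{\mathcal G}\big((F W_l)_3\big)=\hat{\mathcal G}\big((F W_r)_3\big),\qquad \partial_x\hat{\mathcal G}\big((F W_l)_3\big)=\partial_x^{pml}\hat{\mathcal G}\big((F W_r)_3\big),$$ where $(\cdot)_3$ denotes the third component of a vector. Then $\alpha_3=0$, i.e. for any given incoming amplitudes $\alpha_1,\alpha_2$ there is no wave reflected into the Euler medium at the interface between the Euler medium and the infinite PML medium.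
   Context: Constants: $\bar\rho>0$, $\bar c>0$, and a constant subsonic flow $(\bar u,\bar v)\in\mathbb{R}^2$, $\bar u^2+\bar v^2<\bar c^2$, with $\bar u\ne 0$. Write $s=i\omega+ik\bar v$. All operators below are ordinary differential operators in $x$ with constant coefficients (obtained by Fourier transform in $t$ and $y$, with dual variables $\omega$ and $k$), acting on functions of $x$. Transport operator: $\hat{\mathcal G}=s+\bar u\,\partial_x$. Advective wave operator: $\hat{\mathcal L}=s^2+2\bar u s\,\partial_x+\bar c^2k^2-(\bar c^2-\bar u^2)\partial_{xx}$. Euler operator, acting on $(p,u,v)^T$: $$\hat A=\begin{pmatrix}\hat{\mathcal G}&\bar\rho\bar c^2\partial_x& i\bar\rho\bar c^2k\\ \frac1{\bar\rho}\partial_x&\hat{\mathcal G}&0\\ \frac{ik}{\bar\rho}&0&\hat{\mathcal G}\end{pmatrix}.$$ Smith factorization $\hat A=EDF$ with $D=\mathrm{diag}(1,1,\hat{\mathcal G}\hat{\mathcal L})$ and $$E=\begin{pmatrix} i\bar\rho\bar c^2k&0&0\\0&\bar u&0\\ \hat{\mathcal G}&E_2&-\frac{1}{ik\bar u\bar\rho\bar c^2}\end{pmatrix},\quad E_2=\frac{\bar u}{ik\bar c^2 s}\big(\bar u\,\hat{\mathcal L}-\bar c^2 s\,\partial_x\big),\quad F=\begin{pmatrix}\frac{\hat{\mathcal G}}{ik\bar\rho\bar c^2}&\frac{\partial_x}{ik}&1\\ \frac{\partial_x}{\bar\rho\bar u}&\frac{\hat{\mathcal G}}{\bar u}&0\\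 \frac{\bar u}{s}&\frac{\bar\rho\bar u^2}{s}&0\end{pmatrix}.$$ The determinants of $E$ and $F$ are nonzero constants, so $E^{-1}$ and $F^{-1}$ have entries that are polynomials in $\partial_x$. Exponents: $\lambda_1=-s/\bar u$ (the root of $\hat{\mathcal G}e^{\lambda x}=0$), and $\lambda_2,\lambda_3$ are the two roots of $\hat{\mathcal L}e^{\lambda x}=0$: $$\lambda_{2}=\frac{\bar u s-\bar c\,r}{\bar c^2-\bar u^2},\quad \lambda_3=\frac{\bar u s+\bar c\,r}{\bar c^2-\bar u^2},$$ where $r=s\sqrt{1-\frac{k^2(\bar c^2-\bar u^2)}{(\omega+k\bar v)^2}}$ if $|k|\sqrt{\bar c^2-\bar u^2}<|\omega+k\bar v|$, and $r=\sqrt{k^2(\bar c^2-\bar u^2)-(\omega+k\bar v)^2}$ if $|k|\sqrt{\bar c^2-\bar u^2}>|\omega+k\bar v|$. Euler modes: $W_i=e^{-\lambda_i x}F^{-1}(0,0,e^{\lambda_i x})^T$, $i=1,2,3$; these vectors do not depend on $x$. PML derivative: with $a=\dfrac{\bar c s}{\bar c s+(\bar c^2-\bar u^2)\sigma}$, $$\partial_x^{pml}=a\Big[\partial_x-\frac{\bar u s}{\bar c^2-\bar u^2}\Big]+\frac{\bar u s}{\bar c^2-\bar u^2}.$$ PML wave operator: $\hat{\mathcal L}^{pml}=s^2+2\bar u s\,\partial_x^{pml}+\bar c^2k^2-(\bar c^2-\bar u^2)(\partial_x^{pml})^2$. First PML model: $\hat A^{pml1}=E\,D^{pml}F$ with $D^{pml}=\mathrm{diag}(1,1,\hat{\mathcal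 G}\hat{\mathcal L}^{pml})$ ($E$, $F$ and $\hat{\mathcal G}$ are not modified). PML exponents: $\lambda_1^{pml}=\lambda_1$ and, for $i=2,3$, $$\lambda_i^{pml}=\Big(1+\frac{(\bar c^2-\bar u^2)\sigma}{\bar c s}\Big)\Big(\lambda_i-\frac{\bar u s}{\bar c^2-\bar u^2}\Big)+\frac{\bar u s}{\bar c^2-\bar u^2}.$$ PML modes: $W_i^{pml1}=e^{-\lambda_i^{pml}x}F^{-1}(0,0,e^{\lambda_i^{pml}x})^T$, which do not depend on $x$. *)

(* Defs.v *)
From HB Require Import structures.
From mathcomp Require Import all_boot all_order all_algebra.
From mathcomp Require Import all_classical all_reals all_analysis.
From mathcomp Require Import complex ring.

Set Implicit Arguments.
Unset Strict Implicit.
Unset Printing Implicit Defensive.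

Import Order.TTheory GRing.Theory Num.Theory.
Import numFieldNormedType.Exports.

Local Open Scope classical_set_scope.
Local Open Scope ring_scope.
Local Open Scope complex_scope.

Section Functions.
Variable R : realType.
Implicit Types (f : R -> R[i]) (P : {poly R[i]}).

Definition cexp (z : R[i]) : R[i] :=
  (expR (complex.Re z))%:C * (cos (complex.Im z) +i* sin (complex.Im z)).

(* R[i] carries no normed-module structure over R, so the derivative and the
   one-sided limits of a complex-valued function of a real variable are taken
   on the real and imaginary parts. *)
Definition cderive f : R -> R[i] :=
  fun x => derive1 (fun y => complex.Re (f y)) x
         +i* derive1 (fun y => complex.Im (f y)) x.

Definition trace_left f : R[i] :=
  (lim (complex.Re (f x) @[x --> (0 : R)^'-]) : R)
  +i* (lim (complex.Im (f x) @[x --> (0 : R)^'-]) : R).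

Definition trace_right f : R[i] :=
  (lim (complex.Re (f x) @[x --> (0 : R)^'+]) : R)
  +i* (lim (complex.Im (f x) @[x --> (0 : R)^'+]) : R).

(* Constant-coefficient differential operators in x are polynomials in 'X,
   where 'X stands for d/dx; this is their action on functions. *)
Definition dop P f : R -> R[i] :=
  fun x => \sum_(j < size P) P`_j * iter j cderive f x.

Definition dopmx (M : 'M[{poly R[i]}]_3) (w : R -> 'cV[R[i]]_3) :
    R -> 'cV[R[i]]_3 :=
  fun x => \col_i \sum_j dop (M i j) (fun y => w y j 0) x.

Definition third (w : R -> 'cV[R[i]]_3) : R -> R[i] := fun x => w x ord_max 0.

Definition mx3 (rows : seq (seq {poly R[i]})) : 'M[{poly R[i]}]_3 :=
  \matrix_(i, j) (nth [::] rows i)`_j.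

End Functions.

Section Euler.
Variables (R : realType) (rho c u v omega k sigma : R).

Definition symb_s : R[i] := 'i%C * omega%:C + 'i%C * k%:C * v%:C.

Local Notation s := symb_s.
Local Notation dx := ('X : {poly R[i]}).

Definition opG : {poly R[i]} := s%:P + u%:C *: dx.

Definition opL : {poly R[i]} :=
  (s ^+ 2)%:P + (2 * u%:C * s) *: dx + (c%:C ^+ 2 * k%:C ^+ 2)%:P
  - (c%:C ^+ 2 - u%:C ^+ 2) *: dx ^+ 2.

Definition opA : 'M[{poly R[i]}]_3 := mx3
  [:: [:: opG; (rho%:C * c%:C ^+ 2) *: dx; ('i%C * rho%:C * c%:C ^+ 2 * k%:C)%:P];
      [:: (rho%:C)^-1 *: dx; opG; 0];
      [:: ('i%C * k%:C / rho%:C)%:P; 0; opG]].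

Definition opE2 : {poly R[i]} :=
  (u%:C / ('i%C * k%:C * c%:C ^+ 2 * s)) *: (u%:C *: opL - (c%:C ^+ 2 * s) *: dx).

Definition opE : 'M[{poly R[i]}]_3 := mx3
  [:: [:: ('i%C * rho%:C * c%:C ^+ 2 * k%:C)%:P; 0; 0];
      [:: 0; u%:C%:P; 0];
      [:: opG; opE2; (- ('i%C * k%:C * u%:C * rho%:C * c%:C ^+ 2)^-1)%:P]].

Definition opF : 'M[{poly R[i]}]_3 := mx3
  [:: [:: ('i%C * k%:C * rho%:C * c%:C ^+ 2)^-1 *: opG; ('i%C * k%:C)^-1 *: dx; 1];
      [:: (rho%:C * u%:C)^-1 *: dx; (u%:C)^-1 *: opG; 0];
      [:: (u%:C / s)%:P; (rho%:C * u%:C ^+ 2 / s)%:P; 0]].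

Definition opD : 'M[{poly R[i]}]_3 := mx3
  [:: [:: 1; 0; 0]; [:: 0; 1; 0]; [:: 0; 0; opG * opL]].

Definition root_r : R[i] :=
  if `|k| * Num.sqrt (c ^+ 2 - u ^+ 2) < `|omega + k * v| then
    s * (Num.sqrt (1 - k ^+ 2 * (c ^+ 2 - u ^+ 2) / (omega + k * v) ^+ 2))%:C
  else
    (Num.sqrt (k ^+ 2 * (c ^+ 2 - u ^+ 2) - (omega + k * v) ^+ 2))%:C.

Definition lambda1 : R[i] := - s / u%:C.
Definition lambda2 : R[i] :=
  (u%:C * s - c%:C * root_r) / (c%:C ^+ 2 - u%:C ^+ 2).
Definition lambda3 : R[i] :=
  (u%:C * s + c%:C * root_r) / (c%:C ^+ 2 - u%:C ^+ 2).

(* invmx opF is a genuine inverse: the determinant of opF is the constant -1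
   (see det_opF below). The value does not depend on x. *)
Definition mode (lambda : R[i]) (x : R) : 'cV[R[i]]_3 :=
  cexp (- lambda * x%:C) *:
  dopmx (invmx opF)
    (fun y => \col_i (if i == ord_max then cexp (lambda * y%:C) else 0)) x.

Definition pml_shift : R[i] := u%:C * s / (c%:C ^+ 2 - u%:C ^+ 2).

Definition pml_a : R[i] :=
  c%:C * s / (c%:C * s + (c%:C ^+ 2 - u%:C ^+ 2) * sigma%:C).

Definition dx_pml : {poly R[i]} :=
  pml_a *: (dx - pml_shift%:P) + pml_shift%:P.

Definition opL_pml : {poly R[i]} :=
  (s ^+ 2)%:P + (2 * u%:C * s) *: dx_pml + (c%:C ^+ 2 * k%:C ^+ 2)%:P
  - (c%:C ^+ 2 - u%:C ^+ 2) *: dx_pml ^+ 2.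

Definition opD_pml : 'M[{poly R[i]}]_3 := mx3
  [:: [:: 1; 0; 0]; [:: 0; 1; 0]; [:: 0; 0; opG * opL_pml]].

Definition opA_pml1 : 'M[{poly R[i]}]_3 := opE *m opD_pml *m opF.

Definition lambda_pml (lambda : R[i]) : R[i] :=
  (1 + (c%:C ^+ 2 - u%:C ^+ 2) * sigma%:C / (c%:C * s)) * (lambda - pml_shift)
  + pml_shift.

Definition lambda1_pml : R[i] := lambda1.
Definition lambda2_pml : R[i] := lambda_pml lambda2.

End Euler.

Section Smith.
Variables (R : realType) (rho c u v omega k : R).
Hypotheses (rho0 : 0 < rho) (c0 : 0 < c) (u0 : u != 0) (k0 : k != 0).
Hypothesis freq0 : omega + k * v != 0.

Lemma symb_s_neq0 : symb_s v omega k != 0.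
Proof.
have -> : symb_s v omega k = 0 +i* (omega + k * v).
  by rewrite /symb_s; apply/eqP; rewrite eq_complex /=; apply/andP; split;
    apply/eqP; ring.
by rewrite eq_complex /= eqxx.
Qed.

Lemma opA_smith :
  opA rho c u v omega k
  = opE rho c u v omega k *m opD c u v omega k *m opF rho c u v omega k.
Proof.
have s0 := symb_s_neq0.
have C0 (x : R) : x != 0 -> x%:C != 0 by move=> ?; rewrite eq_complex /= eqxx andbT.
have rC := C0 _ (lt0r_neq0 rho0); have cC := C0 _ (lt0r_neq0 c0).
have uC := C0 _ u0; have kC := C0 _ k0.
have iC : ('i%C : R[i]) != 0 by rewrite eq_complex /= oner_eq0 andbF.
have i2 : ('i%C : R[i]) ^+ 2 = -1 by rewrite sqr_i.
rewrite /opA /opE /opD /opF /opE2 /opL /opG.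
move: (symb_s v omega k) s0 => s s0.
move: (rho%:C) (c%:C) (u%:C) (k%:C) ('i%C : R[i]) rC cC uC kC iC i2
 => r0 c1 u1 k1 ii rC cC uC kC iC i2.
have inv1 (x : R[i]) : x != 0 -> x%:P * x^-1%:P = 1 by move=> ?; rewrite -polyCM mulfV.
have Hr := inv1 _ rC; have Hc := inv1 _ cC; have Hu := inv1 _ uC.
have Hk := inv1 _ kC; have Hi := inv1 _ iC; have Hs := inv1 _ s0.
have Hii : ii%:P ^+ 2 = -1 :> {poly R[i]} by rewrite -polyC_exp i2 polyCN.
have Hiv : ii^-1%:P = - ii%:P.
  by rewrite -polyCN; congr (_%:P); apply: (mulfI iC); rewrite mulfV // mulrN -expr2 i2 opprK.
apply/matrixP => i j; rewrite !mxE !big_ord_recl big_ord0 !mxE !big_ord_recl !big_ord0 !mxE.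
case: i => [[|[|[|i]]] // Hi']; case: j => [[|[|[|j]]] // Hj'] /=;
rewrite ?invfM -?exprVn -?mul_polyC ?(polyCM, polyCD, polyCN, polyCB, polyC_exp, polyCMn, polyC1);
first [by ring: Hr Hc Hu Hk Hi Hs Hii | by rewrite Hiv; ring: Hr Hc Hu Hk Hs Hii].
Qed.

Lemma det_opF : \det (opF rho c u v omega k) = -1.
Proof.
have s0 := symb_s_neq0.
have C0 (x : R) : x != 0 -> x%:C != 0 by move=> ?; rewrite eq_complex /= eqxx andbT.
have rC := C0 _ (lt0r_neq0 rho0); have cC := C0 _ (lt0r_neq0 c0).
have uC := C0 _ u0; have kC := C0 _ k0.
rewrite /opF /opG.
move: (symb_s v omega k) s0 => s s0.
move: (rho%:C) (u%:C) rC uC => r0 u1 rC uC.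
have inv1 (x : R[i]) : x != 0 -> x%:P * x^-1%:P = 1 by move=> ?; rewrite -polyCM mulfV.
have Hr := inv1 _ rC; have Hu := inv1 _ uC; have Hs := inv1 _ s0.
rewrite (expand_det_col _ ord_max) !big_ord_recr big_ord0 /= /cofactor.
rewrite !mxE /= !(mul0r, add0r, addr0, mulr0, mul1r).
rewrite (expand_det_row _ ord0) !big_ord_recr big_ord0 /= /cofactor !det_mx11 !mxE /= ?(expr0, exprS, mul1r, mulN1r, opprK).
rewrite ?invfM -?exprVn -?mul_polyC ?(polyCM, polyCD, polyCN, polyCB, polyC_exp, polyCMn, polyC1).
ring: Hr Hu Hs.
Qed.
End Smith.

(* Main.v *)
(** Since [mode l] is [F^-1 (0, 0, exp (l x))] divided by [exp (l x)], the
    third component of [F W] is a plain sum of exponentials on each side. The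
    operator [G] kills the vorticity exponential [l1 = l1_pml], so the last two
    interface conditions read
      [alpha2 G(l2) + alpha3 G(l3) = beta2 G(l2_pml)],
      [alpha2 G(l2) l2 + alpha3 G(l3) l3 = beta2 G(l2_pml) l2],
    because the symbol of [dx_pml] at [l2_pml] is [l2]. Eliminating [beta2]
    leaves [alpha3 G(l3) (l3 - l2) = 0], where [l3 <> l2] away from glancing
    and [G(l3) <> 0]. *)

Require Import Defs.
From mathcomp Require Import all_boot all_order all_algebra.
From mathcomp Require Import all_classical all_reals all_analysis.
From mathcomp Require Import complex.
From mathcomp Require Import ring lra.

Set Implicit Arguments.
Unset Strict Implicit.

Import Order.TTheory GRing.Theory Num.Theory.
Import numFieldNormedType.Exports.
Local Open Scope ring_scope.
Local Open Scope complex_scope.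

(** * Calculus of finite sums of complex exponentials *)

Section ExponentialSums.
Local Open Scope classical_set_scope.
Variable R : realType.
Implicit Types (f g : R -> R[i]) (A : set R) (x : R).

(** [cderive] returns a value even where [f] is not differentiable; this predicate records
    differentiability as well, so the sum and scaling rules can be proved. *)
Definition is_cderive x f (d : R[i]) :=
  is_derive x 1 (fun y => complex.Re (f y)) (complex.Re d) /\
  is_derive x 1 (fun y => complex.Im (f y)) (complex.Im d).

Lemma cderive_val x f d : is_cderive x f d -> cderive f x = d.
Proof.
by case=> fr fi; rewrite /cderive !derive1E !derive_val; case: d {fr fi}.
Qed.

(** The two solutions are known only on open half-lines, so derivatives must be computed from local
    equality. *)
Lemma near_eq_is_cderive x f g d :
  (\forall y \near x, f y = g y) -> is_cderive x f d -> is_cderive x g d.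
Proof.
move=> fg [fr fi]; split; [apply: near_eq_is_derive fr|apply: near_eq_is_derive fi];
  by near=> y; rewrite (near fg y).
Unshelve. all: by end_near. Qed.

Lemma is_cderive_cexp (l : R[i]) x :
  is_cderive x (fun y => cexp (l * y%:C)) (l * cexp (l * x%:C)).
Proof.
case: l => a b.
have scal (t : R) : is_derive x 1 (fun y => t * y) t.
  by apply: is_derive_eq; rewrite [LHS]mulr1.
have reE y : complex.Re ((a +i* b) * y%:C) = a * y by rewrite /= mulr0 subr0.
have imE y : complex.Im ((a +i* b) * y%:C) = b * y by rewrite /= mulr0 add0r.
have de := is_derive1_comp (is_derive_expR (a * x)) (scal a).
have dc := is_derive1_comp (is_derive_cos (b * x)) (scal b).
have ds := is_derive1_comp (is_derive_sin (b * x)) (scal b).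
split.
- rewrite [X in is_derive _ _ X _](_ : _ =
    (expR \o (fun y => a * y)) * (cos \o (fun y => b * y))); last first.
    by apply/funext => y; rewrite /cexp reE imE /= mul0r subr0.
  apply: is_derive_eq.
  by rewrite /cexp reE imE /= /GRing.scale /=; ring.
- rewrite [X in is_derive _ _ X _](_ : _ =
    (expR \o (fun y => a * y)) * (sin \o (fun y => b * y))); last first.
    by apply/funext => y; rewrite /cexp reE imE /= mul0r addr0.
  apply: is_derive_eq.
  by rewrite /cexp reE imE /= /GRing.scale /=; ring.
Qed.

Lemma is_cderive_cst (a : R[i]) x : is_cderive x (cst a) 0.
Proof. by split; exact: is_derive_cst. Qed.

Lemma is_cderiveD x f g df dg : is_cderive x f df -> is_cderive x g dg ->
  is_cderive x (fun y => f y + g y) (df + dg).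
Proof.
move=> [fr fi] [gr gi]; split; rewrite raddfD.
- rewrite [X in is_derive _ _ X _](_ : _ =
    (fun y => complex.Re (f y)) + (fun y => complex.Re (g y))).
    exact: is_deriveD.
  by apply/funext => y; rewrite raddfD.
- rewrite [X in is_derive _ _ X _](_ : _ =
    (fun y => complex.Im (f y)) + (fun y => complex.Im (g y))).
    exact: is_deriveD.
  by apply/funext => y; rewrite raddfD.
Qed.

Lemma is_cderiveZ (a : R[i]) x f d :
  is_cderive x f d -> is_cderive x (fun y => a * f y) (a * d).
Proof.
case: a => a b [fr fi]; split.
- rewrite [X in is_derive _ _ X _](_ : _ =
    a \*: (fun y => complex.Re (f y)) - b \*: (fun y => complex.Im (f y))).
    by apply: is_derive_eq; case: d {fr fi}.
  by apply/funext => y; rewrite !fctE /=; case: (f y).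
- rewrite [X in is_derive _ _ X _](_ : _ =
    a \*: (fun y => complex.Im (f y)) + b \*: (fun y => complex.Re (f y))).
    by apply: is_derive_eq; case: d {fr fi}.
  by apply/funext => y; rewrite !fctE /=; case: (f y).
Qed.

Variable I : finType.
Implicit Types (a l : I -> R[i]) (P : {poly R[i]}).

(** An arbitrary finite index type covers three modes on the left, two on the right and a single
    exponential. *)
Definition expsum a l : R -> R[i] := fun x => \sum_i a i * cexp (l i * x%:C).

Lemma is_cderive_expsum a l x :
  is_cderive x (expsum a l) (expsum (fun i => a i * l i) l x).
Proof.
rewrite /expsum; elim: (index_enum I) => [|i r IHr].
  rewrite big_nil (_ : (fun y => _) = cst 0); first exact: is_cderive_cst.
  by apply/funext => y; rewrite big_nil.
rewrite big_cons (_ : (fun y => _) = (fun y => a i * cexp (l i * y%:C) +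
    \sum_(j <- r) a j * cexp (l j * y%:C))); last first.
  by apply/funext => y; rewrite big_cons.
apply: is_cderiveD IHr; rewrite -mulrA.
exact: is_cderiveZ (is_cderive_cexp _ _).
Qed.

(** Since [A] is open, the formula holds near each of its points; the result has the same shape on
    the same set, so it can be iterated. *)
Lemma cderive_expsum A f a l : open A ->
  (forall x, A x -> f x = expsum a l x) ->
  forall x, A x -> cderive f x = expsum (fun i => a i * l i) l x.
Proof.
move=> oA fE x Ax; apply: cderive_val.
apply: near_eq_is_cderive (is_cderive_expsum _ _ _).
by near=> y; apply/esym/fE; near: y; exact: open_nbhs_nbhs.
Unshelve. all: by end_near. Qed.

Lemma iter_cderive_expsum A f a l n : open A ->
  (forall x, A x -> f x = expsum a l x) ->
  forall x, A x -> iter n (@cderive R) f x = expsum (fun i => a i * l i ^+ n) l x.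
Proof.
move=> oA fE; elim: n => [|n IHn] x Ax /=.
  by rewrite fE//; apply: eq_bigr => i _; rewrite expr0 mulr1.
rewrite (cderive_expsum oA IHn Ax).
by apply: eq_bigr => i _; rewrite exprSr mulrA.
Qed.

(** Each exponential is an eigenfunction of [P] whose eigenvalue is the symbol [P.[l i]], so an
    operator merely rescales the amplitudes. *)
Lemma dop_expsum A f a l P : open A ->
  (forall x, A x -> f x = expsum a l x) ->
  forall x, A x -> dop P f x = expsum (fun i => a i * P.[l i]) l x.
Proof.
move=> oA fE x Ax; rewrite /dop /expsum.
under eq_bigr => j _ do
  rewrite (iter_cderive_expsum _ oA fE Ax) /expsum mulr_sumr.
rewrite exchange_big; apply: eq_bigr => i _.
rewrite horner_coef mulr_sumr mulr_suml; apply: eq_bigr => j _.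
by rewrite !mulrA (mulrC P`_j).
Qed.

Lemma cexp0 : cexp (0 : R[i]) = 1.
Proof. by rewrite /cexp /= expR0 cos0 sin0 mul1r. Qed.

Lemma expsum0 a l : expsum a l 0 = \sum_i a i.
Proof. by apply: eq_bigr => i _; rewrite mulr0 cexp0 mulr1. Qed.

Lemma is_cderive_cvg x f d : is_cderive x f d ->
  complex.Re (f y) @[y --> x] --> complex.Re (f x) /\
  complex.Im (f y) @[y --> x] --> complex.Im (f x).
Proof.
by case=> fr fi; split; apply: differentiable_continuous; apply/derivable1_diffP;
  exact: ex_derive.
Qed.

(** The exponential sum extends [f] continuously across 0, so the one-sided limit is its value
    there, the sum of the amplitudes. *)
Lemma trace_left_expsum f a l :
  (forall x, x < 0 -> f x = expsum a l x) -> trace_left f = \sum_i a i.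
Proof.
move=> fE; rewrite -(expsum0 a l).
have [cr ci] := is_cderive_cvg (is_cderive_expsum a l 0).
have E : \forall y \near (0 : R)^'-, expsum a l y = f y.
  by near=> y; rewrite fE.
rewrite /trace_left.
rewrite (@cvg_lim _ _ _ _ _ _ (complex.Re (expsum a l 0))) //; last first.
  apply: cvg_trans (cvg_at_left_filter cr); apply: near_eq_cvg.
  by near=> y; rewrite (near E y).
rewrite (@cvg_lim _ _ _ _ _ _ (complex.Im (expsum a l 0))) //; last first.
  apply: cvg_trans (cvg_at_left_filter ci); apply: near_eq_cvg.
  by near=> y; rewrite (near E y).
by case: (expsum a l 0).
Unshelve. all: by end_near. Qed.

Lemma trace_right_expsum f a l :
  (forall x, 0 < x -> f x = expsum a l x) -> trace_right f = \sum_i a i.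
Proof.
move=> fE; rewrite -(expsum0 a l).
have [cr ci] := is_cderive_cvg (is_cderive_expsum a l 0).
have E : \forall y \near (0 : R)^'+, expsum a l y = f y.
  by near=> y; rewrite fE.
rewrite /trace_right.
rewrite (@cvg_lim _ _ _ _ _ _ (complex.Re (expsum a l 0))) //; last first.
  apply: cvg_trans (cvg_at_right_filter cr); apply: near_eq_cvg.
  by near=> y; rewrite (near E y).
rewrite (@cvg_lim _ _ _ _ _ _ (complex.Im (expsum a l 0))) //; last first.
  apply: cvg_trans (cvg_at_right_filter ci); apply: near_eq_cvg.
  by near=> y; rewrite (near E y).
by case: (expsum a l 0).
Unshelve. all: by end_near. Qed.

End ExponentialSums.

Lemma mul_cexpN (R : realType) (z : R[i]) : cexp (- z) * cexp z = 1.
Proof.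
case: z => a b; rewrite /cexp /= cosN sinN.
apply/eqP; rewrite eq_complex /=; apply/andP; split; apply/eqP; last by ring.
transitivity ((expR a * expR (- a)) * (cos b ^+ 2 + sin b ^+ 2)); first by ring.
by rewrite expRxMexpNx_1 cos2Dsin2 mulr1.
Qed.

(** * Third component of [F W] for a combination of modes *)

Section Modes.
Variables (R : realType) (rho c u v omega k : R).
Hypotheses (rho0 : 0 < rho) (c0 : 0 < c) (u0 : u != 0) (k0 : k != 0).
Hypothesis freq0 : omega + k * v != 0.

Local Notation F := (opF rho c u v omega k).

(** Only the last column of the inverse of [F] meets a nonzero entry, and its polynomials act on the
    exponential by evaluation at [l]; the prefactor of [mode] then cancels the exponential. *)
Lemma modeE (l : R[i]) x :
  mode rho c u v omega k l x = \col_i (invmx F i ord_max).[l].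
Proof.
apply/colP => i; rewrite !mxE (bigD1 ord_max) //= big1 ?addr0 => [|j jm].
  rewrite (@dop_expsum R 'I_1 setT _ (fun=> 1) (fun=> l)) //; first last.
  - by move=> y _; rewrite /expsum big_ord1 mxE eqxx mul1r.
  - exact: openT.
  by rewrite /expsum big_ord1 mul1r mulrCA mulNr mul_cexpN mulr1.
(* The zero entries are one-term sums with amplitude 0. *)
rewrite (@dop_expsum R 'I_1 setT _ (fun=> 0) (fun=> l)) //; first last.
- by move=> y _; rewrite /expsum big_ord1 mxE (negPf jm) mul0r.
- exact: openT.
by rewrite /expsum big_ord1 !mul0r.
Qed.

(** Evaluating [F *m invmx F = 1] at each exponent, the last diagonal entry gives every mode the
    factor 1. *)
Lemma third_opF_modes (I : finType) (a l : I -> R[i]) (A : set R)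
    (W : R -> 'cV[R[i]]_3) : open A ->
  (forall x, A x -> W x =
     \sum_i (a i * cexp (l i * x%:C)) *: mode rho c u v omega k (l i) x) ->
  forall x, A x -> third (dopmx F W) x = expsum a l x.
Proof.
move=> oA WE x Ax.
have Wj (j : 'I_3) y : A y ->
    W y j 0 = expsum (fun i => a i * (invmx F j ord_max).[l i]) l y.
  move=> Ay; rewrite WE // summxE; apply: eq_bigr => i _.
  by rewrite modeE !mxE mulrAC.
rewrite /third mxE.
under eq_bigr => j _ do rewrite (dop_expsum _ oA (Wj j) Ax).
rewrite /expsum exchange_big; apply: eq_bigr => i _.
rewrite -mulr_suml; congr (_ * _).
under eq_bigr => j _ do rewrite -mulrA (mulrC _.[_]) -hornerM.
rewrite -mulr_sumr -horner_sum.
(* The determinant -1 is a unit of the polynomial ring, so [invmx F] is a true inverse with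
   polynomial entries. *)
have uF : F \in unitmx by rewrite unitmxE det_opF // rpredN rpred1.
by have /matrixP/(_ ord_max ord_max) := mulmxV uF; rewrite !mxE => ->;
  rewrite hornerC mulr1.
Qed.

End Modes.

(** * Exponents and symbols away from glancing *)

Section Algebra.
Variables (R : realType) (c u v omega k sigma : R).
Hypotheses (c0 : 0 < c) (subsonic : u ^+ 2 < c ^+ 2).
Hypothesis freq0 : omega + k * v != 0.
Hypothesis not_glancing : (omega + k * v) ^+ 2 != k ^+ 2 * (c ^+ 2 - u ^+ 2).

Local Notation s := (symb_s v omega k).
Local Notation r := (root_r c u v omega k).
Local Notation l2 := (lambda2 c u v omega k).
Local Notation l3 := (lambda3 c u v omega k).

Lemma real_complex_neq0 (x : R) : x != 0 -> x%:C != 0.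
Proof. by move=> ?; rewrite eq_complex /= eqxx andbT. Qed.

Lemma sqr_symb_s : s ^+ 2 = (- (omega + k * v) ^+ 2)%:C.
Proof.
by apply/eqP; rewrite eq_complex /=; apply/andP; split; apply/eqP; ring.
Qed.

Lemma subsonicC_neq0 : c%:C ^+ 2 - u%:C ^+ 2 != 0.
Proof.
rewrite -!rmorphXn -rmorphB; apply: real_complex_neq0.
by rewrite subr_eq0 gt_eqF.
Qed.

(** Both branches of [root_r] are square roots of the same discriminant, so later arguments can use
    this square without a case split. *)
Lemma sqr_root_r : r ^+ 2 = s ^+ 2 + k%:C ^+ 2 * (c%:C ^+ 2 - u%:C ^+ 2).
Proof.
have D0 : 0 < c ^+ 2 - u ^+ 2 by rewrite subr_gt0.
have W0 : 0 < (omega + k * v) ^+ 2 by rewrite exprn_even_gt0.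
rewrite -!rmorphXn -rmorphB -rmorphM sqr_symb_s -rmorphD /root_r.
(* Written with square roots of squares, the branch test compares [k ^+ 2 * (c ^+ 2 - u ^+ 2)] with
   [(omega + k * v) ^+ 2], which fixes the sign of each radicand. *)
rewrite -!sqrtr_sqr -sqrtrM ?sqr_ge0 // ltr_sqrt //.
case: ltP => h.
  rewrite exprMn sqr_symb_s -rmorphXn -rmorphM; congr (_%:C).
  rewrite sqr_sqrtr; last by rewrite subr_ge0 ler_pdivrMr // mul1r ltW.
  by field.
by rewrite -rmorphXn sqr_sqrtr ?subr_ge0 // addrC.
Qed.

Lemma root_r_neq0 : r != 0.
Proof.
rewrite -sqrf_eq0 sqr_root_r sqr_symb_s -!rmorphXn -rmorphB -rmorphM -rmorphD.
by apply: real_complex_neq0; rewrite addrC subr_eq0 eq_sym.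
Qed.

(** The gap is [2 c r / (c^2 - u^2)], and [r] vanishes only at glancing. *)
Lemma lambda3_neq_lambda2 : l3 != l2.
Proof.
rewrite -subr_eq0 /lambda3 /lambda2 -mulrBl mulf_neq0 ?invr_neq0 ?subsonicC_neq0 //.
rewrite (_ : _ - _ = 2 * c%:C * r); last by ring.
by rewrite !mulf_neq0 ?root_r_neq0 ?pnatr_eq0 // real_complex_neq0 ?gt_eqF.
Qed.

(* [s + u l3 = 0] would give [c s = - u r], hence [s^2 = u^2 k^2 >= 0],
   whereas [s] is a nonzero imaginary number. *)
Lemma opG_lambda3_neq0 : (opG u v omega k).[l3] != 0.
Proof.
have D0 := subsonicC_neq0; have cC := real_complex_neq0 (lt0r_neq0 c0).
rewrite /opG hornerD hornerC hornerZ hornerX; apply/negP => /eqP G0.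
have e1 : c%:C * s + u%:C * r = 0.
  apply: (mulfI cC); rewrite mulr0.
  transitivity ((s + u%:C * l3) * (c%:C ^+ 2 - u%:C ^+ 2)); last by rewrite G0 mul0r.
  by rewrite /lambda3; field.
have e2 : (c%:C ^+ 2 - u%:C ^+ 2) * (s ^+ 2 - u%:C ^+ 2 * k%:C ^+ 2) = 0.
  transitivity ((c%:C * s + u%:C * r) * (c%:C * s - u%:C * r)); last first.
    by rewrite e1 mul0r.
  transitivity (c%:C ^+ 2 * s ^+ 2 - u%:C ^+ 2 * r ^+ 2); last by ring.
  by rewrite sqr_root_r; ring.
move/eqP: e2; rewrite mulf_eq0 (negPf D0) /= sqr_symb_s -!rmorphXn -rmorphM -rmorphB.
apply/negP/real_complex_neq0; rewrite lt_eqF // -exprMn.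
have W0 : 0 < (omega + k * v) ^+ 2 by rewrite exprn_even_gt0.
by have := sqr_ge0 (u * k); lra.
Qed.

(** The damping enters only the real part; the imaginary part is [c * (omega + k * v)]. *)
Lemma pml_denominator_neq0 :
  c%:C * s + (c%:C ^+ 2 - u%:C ^+ 2) * sigma%:C != 0.
Proof.
rewrite eq_complex negb_and; apply/orP; right => /=.
rewrite (_ : _ + _ = c * (omega + k * v)); last by ring.
by rewrite mulf_neq0 // gt_eqF.
Qed.

(** [pml_a] is the inverse of the stretching factor in [lambda_pml], and both act about the same
    centre [pml_shift], so they undo each other. *)
Lemma dx_pml_lambda_pml (l : R[i]) :
  (dx_pml c u v omega k sigma).[lambda_pml c u v omega k sigma l] = l.
Proof.
have D0 := subsonicC_neq0; have cC := real_complex_neq0 (lt0r_neq0 c0).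
have s0 := symb_s_neq0 freq0; have d0 := pml_denominator_neq0.
rewrite /dx_pml !(hornerD, hornerN, hornerC, hornerZ, hornerX) /lambda_pml /pml_a addrK.
set sh := pml_shift _ _ _ _ _; rewrite mulrA.
rewrite (_ : _ * (1 + _) = 1) ?mul1r ?subrK //.
by field; rewrite cC s0.
Qed.

End Algebra.

Theorem mainTheorem1 (R : realType) (rho c u v omega k sigma : R)
    (rho_gt0 : 0 < rho) (c_gt0 : 0 < c)
    (subsonic : u ^+ 2 + v ^+ 2 < c ^+ 2) (u_neq0 : u != 0)
    (k_neq0 : k != 0) (freq_neq0 : omega + k * v != 0)
    (not_glancing : (omega + k * v) ^+ 2 != k ^+ 2 * (c ^+ 2 - u ^+ 2))
    (sigma_ge0 : 0 <= sigma)
    (alpha1 alpha2 alpha3 beta1 beta2 : R[i]) (Wl Wr : R -> 'cV[R[i]]_3)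
    (euler_left : forall x : R, x < 0 ->
       dopmx (opA rho c u v omega k) Wl x = 0)
    (pml_right : forall x : R, 0 < x ->
       dopmx (opA_pml1 rho c u v omega k sigma) Wr x = 0)
    (Wl_def : forall x : R, x < 0 -> Wl x =
       let l1 := lambda1 u v omega k in
       let l2 := lambda2 c u v omega k in
       let l3 := lambda3 c u v omega k in
       let W := mode rho c u v omega k in
       (alpha1 * cexp (l1 * x%:C)) *: W l1 x
       + (alpha2 * cexp (l2 * x%:C)) *: W l2 x
       + (alpha3 * cexp (l3 * x%:C)) *: W l3 x)
    (Wr_def : forall x : R, 0 < x -> Wr x =
       let l1 := lambda1_pml u v omega k in
       let l2 := lambda2_pml c u v omega k sigma in
       let W := mode rho c u v omega k in
       (beta1 * cexp (l1 * x%:C)) *: W l1 x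
       + (beta2 * cexp (l2 * x%:C)) *: W l2 x)
    (interface_L :
       trace_left (dop (opL c u v omega k)
                     (third (dopmx (opF rho c u v omega k) Wl)))
       = trace_right (dop (opL_pml c u v omega k sigma)
                        (third (dopmx (opF rho c u v omega k) Wr))))
    (interface_G :
       trace_left (dop (opG u v omega k)
                     (third (dopmx (opF rho c u v omega k) Wl)))
       = trace_right (dop (opG u v omega k)
                        (third (dopmx (opF rho c u v omega k) Wr))))
    (interface_dG :
       trace_left (dop 'X (dop (opG u v omega k)
                     (third (dopmx (opF rho c u v omega k) Wl))))
       = trace_right (dop (dx_pml c u v omega k sigma)
                        (dop (opG u v omega k)
                           (third (dopmx (opF rho c u v omega k) Wr))))) :
  alpha3 = 0.
Proof.
(* Only the velocity normal to the interface enters the coefficients in x. *)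
have sub : u ^+ 2 < c ^+ 2.
  by apply: le_lt_trans subsonic; rewrite lerDl sqr_ge0.
move: Wl_def Wr_def => /=.
set l1 := lambda1 u v omega k; set l2 := lambda2 c u v omega k.
set l3 := lambda3 c u v omega k; set m1 := lambda1_pml u v omega k.
set m2 := lambda2_pml c u v omega k sigma => Wl_def' Wr_def'.
pose al (i : 'I_3) := [:: alpha1; alpha2; alpha3]`_i.
pose ll (i : 'I_3) := [:: l1; l2; l3]`_i.
pose be (i : 'I_2) := [:: beta1; beta2]`_i.
pose mm (i : 'I_2) := [:: m1; m2]`_i.
have openl : open [set x : R | x < 0]%classic by exact: open_lt.
have openr : open [set x : R | 0 < x]%classic by exact: open_gt.
have thirdl x : x < 0 ->
    third (dopmx (opF rho c u v omega k) Wl) x = expsum al ll x.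
  apply: (third_opF_modes rho_gt0 c_gt0 u_neq0 k_neq0 freq_neq0 openl) => // y y0.
  by rewrite Wl_def' // !big_ord_recl big_ord0 addr0 addrA.
have thirdr x : 0 < x ->
    third (dopmx (opF rho c u v omega k) Wr) x = expsum be mm x.
  apply: (third_opF_modes rho_gt0 c_gt0 u_neq0 k_neq0 freq_neq0 openr) => // y y0.
  by rewrite Wr_def' // !big_ord_recl big_ord0 addr0.
pose G := opG u v omega k.
have Gl := dop_expsum G openl thirdl; have Gr := dop_expsum G openr thirdr.
have dGl := dop_expsum 'X openl Gl.
have dGr := dop_expsum (dx_pml c u v omega k sigma) openr Gr.
move: interface_G interface_dG.
rewrite (trace_left_expsum Gl) (trace_right_expsum Gr).
rewrite (trace_left_expsum dGl) (trace_right_expsum dGr).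
rewrite !big_ord_recl !big_ord0 /al /ll /be /mm /= !addr0 !hornerX.
(* [G] annihilates the vorticity mode. As [m1] is [l1] by definition, [alpha1] and [beta1] both drop
   out. *)
have G1 : G.[l1] = 0.
  by rewrite /G /opG /l1 /lambda1 hornerD hornerC hornerZ hornerX mulrC divfK ?subrr // real_complex_neq0.
rewrite -/m1 (_ : m1 = l1) // G1 !mulr0 !mul0r !add0r.
(* The symbol of the PML derivative at [m2] is [l2], so [beta2 * G.[m2]] occurs in both conditions;
   the first one replaces it in the second. *)
rewrite dx_pml_lambda_pml // -/l2 => <- e2.
have : alpha3 * G.[l3] * (l3 - l2) = 0.
  (* Subtracting [l2] times the first condition from the second removes the [alpha2] terms. *)
  transitivity (alpha2 * G.[l2] * l2 + alpha3 * G.[l3] * l3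
                - (alpha2 * G.[l2] + alpha3 * G.[l3]) * l2); first by ring.
  by rewrite e2 subrr.
move/eqP; rewrite !mulf_eq0 subr_eq0 (negPf (lambda3_neq_lambda2 c_gt0 sub freq_neq0 not_glancing)) //.
by rewrite (negPf (opG_lambda3_neq0 c_gt0 sub freq_neq0)) !orbF => /eqP.
Qed.
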